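(* Let $V$ be the Virasoro-like algebra over $\mathbb{C}$, with Lie bracket $[\cdot,\cdot]$. For every complex number $\delta$, every transposed $\delta$-Poisson algebra structure $(V,\cdot,[\cdot,\cdot])$ on the Lie algebra $(V,[\cdot,\cdot])$ is trivial; that is, $V$ admits no nontrivial transposed $\delta$-Poisson algebra structures.
   Context: For $\mathbf{m}=(m_1,m_2),\mathbf{n}=(n_1,n_2)\in\mathbb{Z}^2$ write $\det\binom{\mathbf{n}}{\mathbf{m}}=n_1m_2-n_2m_1$. The Virasoro-like algebra $V$ is the complex Lie algebra with basis $\{L_{\mathbf{m}}\mid \mathbf{m}\in\mathbb{Z}^2\setminus\{\mathbf{0}\}\}$ and bracket $[L_{\mathbf{m}},L_{\mathbf{n}}]=\det\binom{\mathbf{n}}{\mathbf{m}}L_{\mathbf{m}+\mathbf{n}}$, with the convention $L_{\mathbf{0}}=0$. Let $\delta\in\mathbb{C}$. A transposed $\delta$-Poisson algebra is a triple $(L,\cdot,[\cdot,\cdot])$ where $(L,\cdot)$ is a commutative associative algebra (not necessarily unital), $(L,[\cdot,\cdot])$ is a Lie algebra on the same vector space, and $x\cdot[y,z]=\delta([x\cdot y,z]+[y,x\cdot z])$ for all $x,y,z\in L$. It is called trivial if $L\cdot L=0$ or $[L,L]=0$. A transposed $\delta$-Poisson algebra structure on a Lie algebra $(L,[\cdot,\cdot])$ is a product $\cdot$ on $L$ such that $(L,\cdot,[\cdot,\cdot])$ is a transposed $\delta$-Poisson algebra. *)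

(* Defs.v *)
From HB Require Import structures.
From mathcomp Require Import all_boot all_order all_algebra finmap.
From mathcomp Require Import sesquilinear ring.
From mathcomp Require Import monalg.

Set Implicit Arguments.
Unset Strict Implicit.
Unset Printing Implicit Defensive.

Import GRing.Theory.
Local Open Scope ring_scope.

HB.mixin Record Lmodule_isLieAlgebra (K : fieldType) L of GRing.Lmodule K L := {
  lie : L -> L -> L;
  lie_bilinear : bilinear_for *:%R *:%R lie;
  lie_alt : forall x, lie x x = 0;
  lie_jacobi : forall x y z,
    lie x (lie y z) + lie y (lie z x) + lie z (lie x y) = 0
}.

#[short(type="lieAlgType")]
HB.structure Definition LieAlgebra (K : fieldType) :=
  { L of GRing.Lmodule K L & Lmodule_isLieAlgebra K L }.

Notation "[lie x , y ]" := (lie x y)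
  (at level 0, x, y at level 99, format "[lie  x ,  y ]") : ring_scope.

Definition transposed_poisson (K : fieldType) (L : lieAlgType K) (delta : K)
    (mul : L -> L -> L) : Prop :=
  [/\ bilinear_for *:%R *:%R mul,
      commutative mul,
      associative mul &
      forall x y z,
        mul x [lie y, z] = delta *: ([lie mul x y, z] + [lie y, mul x z])].

Definition trivial_poisson (K : fieldType) (L : lieAlgType K)
    (mul : L -> L -> L) : Prop :=
  (forall x y, mul x y = 0) \/ (forall x y : L, [lie x, y] = 0).

(* The determinant of the matrix with rows n and m, in this order. *)
Definition det2 (n m : int * int) : int := n.1 * m.2 - n.2 * m.1.

Record nzpair := NzPair { nzval :> int * int; _ : nzval != 0 }.
HB.instance Definition _ := [isSub for nzval].
HB.instance Definition _ := [Choice of nzpair by <:].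

Definition virasoro_like (K : fieldType) : Type :=
  {malg K[nzpair]}.

Section VirasoroLike.
Variable K : fieldType.
Local Notation V := (virasoro_like K).

HB.instance Definition _ := GRing.Lmodule.on V.

(* L_m, with the convention L_0 = 0. *)
Definition Lgen (m : int * int) : V :=
  if insub m is Some k then << k >> else 0.

Definition virasoro_bracket (x y : V) : V :=
  \sum_(m <- msupp x) \sum_(n <- msupp y)
    (x@_m * y@_n) *: ((det2 (val n) (val m))%:~R *: Lgen (val m + val n)).

Lemma Lgen0 : Lgen 0 = 0.
Proof. by rewrite /Lgen insubF // eqxx. Qed.

Lemma Lgen_val (k : nzpair) : Lgen (val k) = << k >>.
Proof. by rewrite /Lgen valK. Qed.

Lemma Lgen_coeff (k k' : nzpair) : (Lgen (val k))@_k' = (k == k')%:R.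
Proof. by rewrite Lgen_val mcoeffU. Qed.

Lemma virasoro_basis (x : V) : x = \sum_(k <- msupp x) x@_k *: Lgen (val k).
Proof.
rewrite {1}[x]monalgE; apply: eq_bigr => k _; rewrite Lgen_val.
by apply/malgP => k'; rewrite mcoeffZ !mcoeffU mulrnAr mulr1.
Qed.

(* The linear map V -> V sending the basis vector L_k to f k. *)
Definition lin_ext (f : nzpair -> V) (x : V) : V :=
  \sum_(k <- msupp x) x@_k *: f k.

Lemma lin_extw f x (d : {fset nzpair}) :
  (msupp x `<=` d)%fset -> lin_ext f x = \sum_(k <- d) x@_k *: f k.
Proof.
move=> le; rewrite /lin_ext [RHS](bigID (fun k => k \in msupp x)) /= addrC.
rewrite [X in X + _]big1 ?add0r => [|k kx]; last by rewrite mcoeff_outdom ?scale0r.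
rewrite -[RHS]big_filter; apply: perm_big; apply: uniq_perm.
- exact: fset_uniq.
- by rewrite filter_uniq // fset_uniq.
by move=> k; rewrite mem_filter; case: (boolP (k \in msupp x)) => // /(fsubsetP le) ->.
Qed.

Lemma lin_ext_linear f : linear (lin_ext f).
Proof.
move=> c x y; set d := (msupp x `|` msupp y `|` msupp (c *: x + y))%fset.
rewrite !(@lin_extw f _ d); try by apply/fsubsetP=> k; rewrite !inE => ->; rewrite ?orbT.
rewrite scaler_sumr -big_split; apply: eq_bigr => k _ /=.
by rewrite mcoeffD mcoeffZ scalerDl scalerA.
Qed.

Lemma lin_extU f k : lin_ext f << k >> = f k.
Proof. by rewrite (lin_extw _ msuppU_le) big_seq_fset1 mcoeffUU scale1r. Qed.

Lemma virasoro_bracketEl x y : virasoro_bracket x y =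
  lin_ext (fun m => lin_ext (fun n =>
    (det2 (val n) (val m))%:~R *: Lgen (val m + val n)) y) x.
Proof.
apply: eq_bigr => m _; rewrite scaler_sumr; apply: eq_bigr => n _.
by rewrite [RHS]scalerA.
Qed.

Lemma virasoro_bracket_bilinear : bilinear_for *:%R *:%R virasoro_bracket.
Proof.
split=> [y c x x' | x c y y'] /=.
  by rewrite !virasoro_bracketEl lin_ext_linear.
rewrite !virasoro_bracketEl /lin_ext -/(lin_ext _ _) scaler_sumr -big_split.
apply: eq_bigr => m _ /=.
rewrite -!/(lin_ext _ _) lin_ext_linear scalerDr !scalerA.
by rewrite mulrC.
Qed.

Lemma virasoro_bracketL (m n : int * int) :
  virasoro_bracket (Lgen m) (Lgen n) = (det2 n m)%:~R *: Lgen (m + n).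
Proof.
have [-> | m0] := eqVneq m 0.
  rewrite virasoro_bracketEl /lin_ext Lgen0 msupp0 big_nil.
  by rewrite /det2 !mulr0 subr0 scale0r.
have [-> | n0] := eqVneq n 0.
  rewrite virasoro_bracketEl /lin_ext Lgen0 msupp0.
  rewrite big1 => [|k _]; last by rewrite big_nil scaler0.
  by rewrite /det2 !mul0r subr0 scale0r.
rewrite -[m]/(val (NzPair m0)).
rewrite -[n]/(val (NzPair n0)).
by rewrite [in LHS]Lgen_val [in LHS]Lgen_val virasoro_bracketEl !lin_extU.
Qed.

Lemma virasoro_ind (P : V -> Prop) :
  (forall c x y, P x -> P y -> P (c *: x + y)) -> (forall m, P (Lgen m)) ->
  forall x, P x.
Proof.
move=> PD PL x; rewrite [x]virasoro_basis.
have P0 : P 0 by rewrite -Lgen0.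
elim: (enum_fset (msupp x)) => [|k s IHs]; first by rewrite big_nil.
by rewrite big_cons; apply: PD.
Qed.

Let brl y c x x' : virasoro_bracket (c *: x + x') y =
  c *: virasoro_bracket x y + virasoro_bracket x' y.
Proof. exact: (virasoro_bracket_bilinear.1 y). Qed.

Let brr x c y y' : virasoro_bracket x (c *: y + y') =
  c *: virasoro_bracket x y + virasoro_bracket x y'.
Proof. exact: (virasoro_bracket_bilinear.2 x). Qed.

Let brZ x c y : virasoro_bracket x (c *: y) = c *: virasoro_bracket x y.
Proof.
have br0 : virasoro_bracket x 0 = 0.
  have := brr x 1 0 0; rewrite !scale1r addr0 => h.
  by apply: (addrI (virasoro_bracket x 0)); rewrite -h addr0.
by have := brr x c y 0; rewrite br0 !addr0.
Qed.

Let brC x y : virasoro_bracket x y = - virasoro_bracket y x.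
Proof.
elim/virasoro_ind: x y => [c x x' IHx IHx' y | m y].
  by rewrite brl brr IHx IHx' opprD scalerN.
elim/virasoro_ind: y => [c y y' IHy IHy' | n].
  by rewrite brl brr IHy IHy' opprD scalerN.
rewrite !virasoro_bracketL [n + m]addrC -scaleNr -rmorphN; congr (_%:~R *: _).
by rewrite /det2; ring.
Qed.

Lemma virasoro_bracket_alt x : virasoro_bracket x x = 0.
Proof.
elim/virasoro_ind: x => [c x y IHx IHy | m].
  rewrite brl brr [virasoro_bracket y _]brr IHx IHy scaler0 addr0.
  by rewrite add0r [virasoro_bracket y x]brC scalerN subrr.
by rewrite virasoro_bracketL /det2 mulrC subrr scale0r.
Qed.

Lemma virasoro_bracket_jacobi x y z :
  virasoro_bracket x (virasoro_bracket y z)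
  + virasoro_bracket y (virasoro_bracket z x)
  + virasoro_bracket z (virasoro_bracket x y) = 0.
Proof.
have rearr (c : K) (a b d a' b' d' : V) : a + b + d = 0 -> a' + b' + d' = 0 ->
    (c *: a + a') + (c *: b + b') + (c *: d + d') = 0.
  by move=> h h'; rewrite (addrACA (c *: a)) (addrACA (c *: a + _)) -!scalerDr h h' scaler0 addr0.
elim/virasoro_ind: x y z => [c x x' IHx IHx' y z | m y z].
  by rewrite !(brl, brr); apply: rearr.
elim/virasoro_ind: y z => [c y y' IHy IHy' z | n z].
  by rewrite !(brl, brr); apply: rearr.
elim/virasoro_ind: z => [c z z' IHz IHz' | p].
  by rewrite !(brl, brr); apply: rearr.
rewrite !(virasoro_bracketL, brZ) !scalerA.
rewrite [n + (p + m)]addrC [p + (m + n)]addrC -[p + m + n]addrA [p + (m + n)]addrC.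
rewrite -[m + n + p]addrA -!scalerDl -!rmorphM -!rmorphD /=.
rewrite [X in X%:~R *: _](_ : _ = 0) ?scale0r //.
by rewrite /det2 /=; ring.
Qed.

HB.instance Definition _ := Lmodule_isLieAlgebra.Build K V
  virasoro_bracket_bilinear virasoro_bracket_alt virasoro_bracket_jacobi.

Lemma virasoro_lieL (m n : int * int) :
  [lie Lgen m, Lgen n] = (det2 n m)%:~R *: Lgen (m + n).
Proof. exact: virasoro_bracketL. Qed.

End VirasoroLike.

(* Main.v *)
(* Let f_k(a, b) be the coefficient of L_(a+b+k) in L_a . L_b.  For fixed k and
   a, with s = a + k, the compatibility axiom says that g = f_k(a, -) is a
   homogeneous delta-derivation of degree s.  For delta <> 0, evaluating it at
   (b, 2b) gives g(2b) = 2 g(b), and comparing (2b, 2c) with (b, c) then shows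
   that g is proportional to det(s, -).  Together with the symmetry of f_k this
   forces f_k = 0, for every delta <> 0; associativity plays no role, and the
   values delta = 1/2, 1, for which V has nonzero delta-derivations, are not
   special.  If delta = 0, use that V is perfect. *)
Require Import Defs.
From mathcomp Require Import all_boot all_order all_algebra complex reals.
From mathcomp Require Import ring monalg.

Set Implicit Arguments.
Unset Strict Implicit.
Unset Printing Implicit Defensive.

Import GRing.Theory Num.Theory.
Local Open Scope ring_scope.

(** * The determinant form on the lattice *)

Section Determinant.
Variable K : numFieldType.
Implicit Types s x y z : int * int.

Definition detK x y : K := (det2 x y)%:~R.

Lemma detKDl x y z : detK (x + y) z = detK x z + detK y z.
Proof. by rewrite /detK -rmorphD; congr (_%:~R); rewrite /det2 /=; ring. Qed.

Lemma detKC x y : detK x y = - detK y x.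
Proof. by rewrite /detK -rmorphN; congr (_%:~R); rewrite /det2; ring. Qed.

Lemma detKDr z x y : detK z (x + y) = detK z x + detK z y.
Proof. by rewrite detKC detKDl opprD -!detKC. Qed.

Lemma detKNl x y : detK (- x) y = - detK x y.
Proof. by rewrite /detK -rmorphN; congr (_%:~R); rewrite /det2 /=; ring. Qed.

Lemma detKNr x y : detK y (- x) = - detK y x.
Proof. by rewrite detKC detKNl -detKC. Qed.

Lemma detKxx x : detK x x = 0.
Proof. by rewrite /detK /det2 mulrC subrr. Qed.

Lemma detK0 x : detK x 0 = 0.
Proof. by rewrite /detK /det2 !mulr0 subrr. Qed.

Lemma det0K x : detK 0 x = 0.
Proof. by rewrite detKC detK0 oppr0. Qed.

Definition detKE := (detKDl, detKDr, detKNl, detKNr, detKxx, detK0, det0K).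

Lemma detK_nondegenerate s : s != 0 -> exists c, detK s c != 0.
Proof.
(* The witness is s turned by a right angle, so the determinant is s1^2 + s2^2. *)
case: s => s1 s2 s0; exists (- s2, s1).
rewrite /detK intr_eq0 /det2 /= mulrN opprK.
apply: contra s0; rewrite -!expr2 paddr_eq0 ?sqr_ge0 // !sqrf_eq0.
by case/andP=> /eqP -> /eqP ->.
Qed.

(** Cramer's rule: det(s, c) x = det(s, x) c - det(c, x) s. *)
Lemma detK_basis_eq0 s c x :
  detK s c != 0 -> detK s x = 0 -> detK c x = 0 -> x = 0.
Proof.
rewrite /detK intr_eq0 => sc /eqP; rewrite intr_eq0 => /eqP sx /eqP.
rewrite intr_eq0 => /eqP cx; case: s c x sc sx cx => [s1 s2] [c1 c2] [x1 x2].
rewrite /det2 /= => sc sx cx.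
congr (_, _); apply/eqP; rewrite -(mulrI_eq0 _ (mulfI sc)).
  rewrite (_ : _ * x1 = c1 * (s1 * x2 - s2 * x1) - s1 * (c1 * x2 - c2 * x1)).
    by rewrite sx cx !mulr0 subrr.
  by ring.
rewrite (_ : _ * x2 = c2 * (s1 * x2 - s2 * x1) - s2 * (c1 * x2 - c2 * x1)).
  by rewrite sx cx !mulr0 subrr.
by ring.
Qed.

End Determinant.

(** * Homogeneous delta-derivations of degree s *)

Section HomogeneousDeltaDerivation.
Variables (K : numFieldType) (delta : K) (s : int * int) (g : int * int -> K).
Local Notation w := (@detK K).
Hypothesis delta0 : delta != 0.
Hypothesis g0 : g 0 = 0.
Hypothesis gE : forall b c,
  w c b * g (b + c) = delta * (g b * w c (b + s) + g c * w (c + s) b).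

Lemma delta_derivation_double b : w s b != 0 -> g (b + b) = g b + g b.
Proof.
move=> sb; have := gE b (b + b).
rewrite !detKE (detKC K b s) !add0r mul0r => /esym/eqP.
rewrite mulf_eq0 (negPf delta0) /= => /eqP E; apply: (mulIf sb).
apply/eqP; rewrite -subr_eq0 -[X in _ == X]E; apply/eqP.
by move: (g (b + b)) (g b) (w s b) => x y z; ring.
Qed.

Lemma delta_derivation_prop_generic b c :
  w s b != 0 -> w s c != 0 -> w s (b + c) != 0 ->
  g b * w s c = g c * w s b.
Proof.
move=> sb sc sbc; have E := gE b c; have := gE (b + b) (c + c).
(* Regrouping 2b + 2c as 2(b + c) lets doubling apply at b, c and b + c, one nonvanishing hypothesis
   for each. *)
rewrite addrACA !delta_derivation_double //.
(* Under doubling of b and c, the terms with the factor det(c, b) scale by 8 and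
   those with a determinant involving s by 4, so the latter add up to 0. *)
move: E; rewrite !detKE (detKC K c s).
move: (w c b) (w s b) (w s c) (g b) (g c) (g (b + c)) => W B C x y z E E2.
apply/eqP; rewrite -subr_eq0.
have : delta *+ 4 * (x * C - y * B) = 0.
  have -> : delta *+ 4 * (x * C - y * B) =
    delta * ((x + x) * (W + W - C + (W + W - C))
             + (y + y) * (W + W + (W + W) + (B + B)))
    - 8%:R * (delta * (x * (W - C) + y * (W + B))) by ring.
  by rewrite -E -E2; ring.
by move/eqP; rewrite mulf_eq0 mulrn_eq0 (negPf delta0).
Qed.

Lemma delta_derivation_prop b c :
  w s b != 0 -> w s c != 0 -> g b * w s c = g c * w s b.
Proof.
move=> sb sc; have [sbc|] := eqVneq (w s (b + c)) 0; last first.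
  exact: delta_derivation_prop_generic.
(* Replacing c by 2c escapes the degenerate case: det(s, b + 2c) = det(s, c) once det(s, b + c) =
   0. *)
have := @delta_derivation_prop_generic b (c + c) sb.
rewrite delta_derivation_double // addrA (detKDr _ s (b + c)) sbc add0r detKDr.
move=> H.
have sc2 : w s c + w s c != 0 by rewrite -mulr2n mulrn_eq0.
have {H sc2} H := H sc2 sc.
have two0 : (2 : K) != 0 by rewrite pnatr_eq0.
by apply: (mulfI two0); rewrite !mulr_natl !mulr2n -mulrDr -mulrDl.
Qed.

(** Split x as (x - c) + c, with both summands off the line of s. Since det(s, x - c) = -det(s, c),
    proportionality gives g(x - c) = -g(c). *)
Lemma delta_derivation_parallel x c :
  w s x = 0 -> w s c != 0 -> g x = 0.
Proof.
move=> sx sc; have [-> //|x0] := eqVneq x 0.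
have cx : w c x != 0.
  by apply: contra x0 => /eqP cx; rewrite (detK_basis_eq0 sc sx cx).
have sxc : w s (x - c) != 0 by rewrite !detKE sx add0r oppr_eq0.
have gsum : g (x - c) + g c = 0.
  have := delta_derivation_prop sxc sc; rewrite !detKE sx add0r mulrN => /eqP.
  by rewrite -addr_eq0 -mulrDl mulf_eq0 (negPf sc) orbF => /eqP.
(* Both determinants on the right equal det(c, x) - det(s, c), so [gsum] cancels that side. *)
have := gE (x - c) c; rewrite subrK !detKE sx (detKC K c s) !subr0 !add0r.
rewrite -mulrDl gsum mul0r mulr0 => /eqP.
by rewrite mulf_eq0 (negPf cx) => /eqP.
Qed.

Lemma delta_derivation_proportional b c : g b * w s c = g c * w s b.
Proof.
have [sb|sb] := eqVneq (w s b) 0; have [sc|sc] := eqVneq (w s c) 0.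
- by rewrite sb sc !mulr0.
- by rewrite (delta_derivation_parallel sb sc) sb mul0r mulr0.
- by rewrite (delta_derivation_parallel sc sb) sc mul0r mulr0.
exact: delta_derivation_prop.
Qed.

End HomogeneousDeltaDerivation.

(** * Homogeneous components of the product *)

Section HomogeneousProduct.
Variables (K : numFieldType) (delta : K) (k : int * int).
Variable f : int * int -> int * int -> K.
Local Notation w := (@detK K).
Hypothesis fC : forall a b, f a b = f b a.
Hypothesis f0 : forall a, f a 0 = 0.
Hypothesis fE : forall a b c, w c b * f a (b + c) =
  delta * (f a b * w c (b + (a + k)) + f a c * w (c + (a + k)) b).

Lemma homogeneous_prop (delta0 : delta != 0) a b c :
  f a b * w (a + k) c = f a c * w (a + k) b.
Proof. exact: (delta_derivation_proportional delta0 (f0 a) (fE a)). Qed.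

Lemma homogeneous_parallel a c :
  delta != 0 -> a + k != 0 -> w (a + k) c = 0 -> f a c = 0.
Proof.
move=> delta0 /(detK_nondegenerate K)[b ab] ac.
have /eqP := homogeneous_prop delta0 a c b.
by rewrite ac mulr0 mulf_eq0 (negPf ab) orbF => /eqP.
Qed.

(** Proportionality to det(a + k, -) leaves one scalar for each a, read off at any point not
    parallel to a + k. *)
Lemma homogeneous_transfer a b c :
  delta != 0 -> w (a + k) c != 0 -> f a c = 0 -> f a b = 0.
Proof.
move=> delta0 ac fac; have /eqP := homogeneous_prop delta0 a b c.
by rewrite fac mul0r mulf_eq0 (negPf ac) orbF => /eqP.
Qed.

Lemma homogeneous_deg0 : delta != 0 -> k = 0 -> forall a b, f a b = 0.
Proof.
move=> delta0 k0 a b; have P := homogeneous_prop delta0; rewrite k0 in P.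
have [->|a0] := eqVneq a 0; first by rewrite fC f0.
have [ab|ab] := eqVneq (w a b) 0.
  by apply: homogeneous_parallel; rewrite ?k0 ?addr0.
have ba : w b a != 0 by rewrite detKC oppr_eq0.
(* The three instances give f(a, b) = f(a, a + b), f(b, a) = f(b, a + b) and f(a + b, a) = -f(a + b,
   b). By symmetry f(a, b) = -f(a, b). *)
have := P a b (a + b); rewrite !addr0 !detKE add0r => /(mulIf ab) fa.
have := P b a (a + b); rewrite !addr0 !detKE addr0 => /(mulIf ba) fb.
have := P (a + b) a b; rewrite !addr0 !detKE addr0 add0r fC -fa.
rewrite (fC (a + b)) -fb (fC b) (detKC _ b a) mulrN => /eqP.
rewrite -addr_eq0 -mulr2n mulrn_eq0 /= mulf_eq0 (negPf ab) orbF.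
by move/eqP.
Qed.

(** At a = -k the degree a + k is 0 and proportionality says nothing. Symmetry leaves only f(-k, -k)
    to treat. *)
Lemma homogeneous_neg_deg :
  k != 0 -> (forall a b, a != - k -> f a b = 0) -> forall a b, f a b = 0.
Proof.
move=> k0 fN a b; have [->|/fN //] := eqVneq a (- k).
have [->|bk] := eqVneq b (- k); last by rewrite fC fN.
have [c kc] := detK_nondegenerate K k0.
have ck : w c k != 0 by rewrite detKC oppr_eq0.
have cNk : c != - k by apply: contra kc => /eqP ->; rewrite !detKE oppr0.
have bNk : - k - c != - k.
  apply: contra kc; rewrite -subr_eq0 addrAC subrr add0r oppr_eq0 => /eqP ->.
  by rewrite detK0.
(* The summands -k - c and c of -k both differ from -k, which kills the right side; the left factor
   is -det(c, k). *)
have := fE (- k) (- k - c) c.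
rewrite subrK (fC _ (- k - c)) (fC _ c) (fN _ _ bNk) (fN _ _ cNk).
rewrite !mul0r addr0 mulr0 !detKE.
by rewrite subr0 => /eqP; rewrite mulf_eq0 oppr_eq0 (negPf ck) => /eqP.
Qed.

Lemma homogeneous_degN0 : delta != 0 -> k != 0 -> forall a b, f a b = 0.
Proof.
move=> delta0 k0.
have f_indep a b : w a k != 0 -> f a b = 0.
  move=> ak; have a0 : a != 0 by apply: contra ak => /eqP ->; rewrite det0K.
  (* By symmetry f(a, a - k) = f(a - k, a), and a is parallel to its own degree (a - k) + k = a.
     Moreover det(a + k, a - k) = -2 det(a, k). *)
  apply: (@homogeneous_transfer a b (a - k)) => //.
    rewrite !detKE (detKC _ k a) subr0 add0r -opprD oppr_eq0 -mulr2n.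
    by rewrite mulrn_eq0.
  by rewrite fC; apply: homogeneous_parallel; rewrite ?subrK ?detKxx.
apply: homogeneous_neg_deg => // a b aNk.
have [ak|/f_indep //] := eqVneq (w a k) 0.
have [c kc] := detK_nondegenerate K k0.
(* Here a is parallel to k and c is not, so f(a, c) = f(c, a) falls under [f_indep]. *)
apply: (@homogeneous_transfer a b c) => //; last first.
  by rewrite fC f_indep // detKC oppr_eq0.
apply: contra aNk => akc; rewrite -addr_eq0; apply/eqP.
apply: (detK_basis_eq0 kc); first by rewrite !detKE detKC ak oppr0 addr0.
by rewrite detKC (eqP akc) oppr0.
Qed.

Lemma homogeneous_product_eq0 a b : f a b = 0.
Proof.
have [delta0|delta0] := eqVneq delta 0; last first.
  have [k0|k0] := eqVneq k 0; first exact: homogeneous_deg0.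
  exact: homogeneous_degN0.
have [-> //|b0] := eqVneq b 0.
have [c bc] := detK_nondegenerate K b0.
(* Perfectness: L_b is a nonzero multiple of [L_(b-c), L_c]. *)
have := fE a (b - c) c; rewrite subrK delta0 mul0r !detKE subr0 => /eqP.
by rewrite mulf_eq0 detKC oppr_eq0 (negPf bc) => /eqP.
Qed.

End HomogeneousProduct.

(** * Coefficients of brackets *)

Section VirasoroLikeCoefficients.
Variable K : numFieldType.
Local Notation V := (virasoro_like K).

(* The coefficient of L_d, taken to be 0 at d = 0 in accordance with L_0 = 0. *)
Definition vcoef (d : int * int) (x : V) : K :=
  if insub d is Some n then x@_(n : nzpair) else 0.

Lemma vcoef_linear d c (x y : V) :
  vcoef d (c *: x + y) = c * vcoef d x + vcoef d y.
Proof.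
rewrite /vcoef; case: insubP => [n _ _|_]; last by rewrite mulr0 addr0.
by rewrite mcoeffD mcoeffZ.
Qed.

Lemma vcoef0 d : vcoef d 0 = 0.
Proof. by rewrite /vcoef; case: insubP => // n _ _; rewrite mcoeff0. Qed.

Lemma vcoefZ d c (x : V) : vcoef d (c *: x) = c * vcoef d x.
Proof. by rewrite -[c *: x]addr0 vcoef_linear vcoef0 addr0. Qed.

Lemma vcoefD d (x y : V) : vcoef d (x + y) = vcoef d x + vcoef d y.
Proof. by rewrite -[x]scale1r vcoef_linear mul1r scale1r. Qed.

Lemma vcoef_Lgen d m : vcoef d (Lgen K m) = ((m == d) && (d != 0))%:R.
Proof.
rewrite /vcoef; case: insubP => [n d0 <-|]; last by rewrite negbK => ->; rewrite andbF.
rewrite (valP n) andbT.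
have [->|m0] := eqVneq m 0; first by rewrite Lgen0 mcoeff0 eq_sym (negPf (valP n)).
by rewrite -[m]/(val (NzPair m0)) Lgen_coeff val_eqE.
Qed.

Lemma vcoef_inj (x : V) : (forall d, vcoef d x = 0) -> x = 0.
Proof.
move=> x0; apply/malgP => n; rewrite mcoeff0.
by have := x0 (val n); rewrite /vcoef valK.
Qed.

Lemma lie_linearl (y : V) c x x' :
  [lie c *: x + x', y] = c *: [lie x, y] + [lie x', y].
Proof. exact: (lie_bilinear.1 y c x x'). Qed.

Lemma lie_anti (x y : V) : [lie x, y] = - [lie y, x].
Proof.
have linr z c u u' : [lie z, c *: u + u'] = c *: [lie z, u] + [lie z, u'] :> V.
  exact: (lie_bilinear.2 z c u u').
have := lie_alt (1 *: x + y).
rewrite lie_linearl !linr !scale1r !lie_alt add0r addr0.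
by move/eqP; rewrite addr_eq0 => /eqP.
Qed.

(** Only the L_(d-c) term of x contributes to L_d. The formula survives at d = 0 because det(c, -c)
    = 0. *)
Lemma vcoef_lie d (x : V) c :
  vcoef d [lie x, Lgen K c] = vcoef (d - c) x * detK K c (d - c).
Proof.
elim/virasoro_ind: x => [e x y IHx IHy | m].
  by rewrite lie_linearl !vcoef_linear IHx IHy mulrDl mulrA.
rewrite virasoro_lieL vcoefZ !vcoef_Lgen -/(detK K c m) [m == _]eq_sym.
rewrite subr_eq [d == _]eq_sym.
have [<-|_] := eqVneq (m + c) d; last by rewrite mulr0 mul0r.
rewrite addrK /= mulrC; have [->|m0] := eqVneq m 0; first by rewrite detK0 !mulr0.
have [/eqP|//] := eqVneq (m + c) 0.
by rewrite addr_eq0 => /eqP ->; rewrite !detKE oppr0 !mulr0.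
Qed.

Lemma vcoef_lier d (x : V) c :
  vcoef d [lie Lgen K c, x] = vcoef (d - c) x * detK K (d - c) c.
Proof.
by rewrite lie_anti -scaleN1r vcoefZ vcoef_lie (detKC _ (d - c)) mulN1r mulrN.
Qed.

End VirasoroLikeCoefficients.

(** * Vanishing of the product *)

Lemma transposed_poisson_eq0 (K : numFieldType) (delta : K)
    (mul : virasoro_like K -> virasoro_like K -> virasoro_like K) :
  transposed_poisson delta mul -> forall x y, mul x y = 0.
Proof.
case=> [[mull mulr] mulC _ mulE].
have mulr0 x : mul x 0 = 0.
  have := mulr x (-1) 0 0; rewrite scaler0 addr0 => ->.
  by rewrite /= scaleN1r addNr.
have mulZ x c y : mul x (c *: y) = c *: mul x y.
  by have := mulr x c y 0; rewrite /= !addr0 mulr0 addr0.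
have mulLL a b : mul (Lgen K a) (Lgen K b) = 0.
  apply: vcoef_inj => d.
  pose f k a b := vcoef (a + b + k) (mul (Lgen K a) (Lgen K b)).
  rewrite (_ : vcoef _ _ = f (d - (a + b)) a b); last by rewrite /f addrC subrK.
  (* The degree k is generalized so that it stays fixed while a and b vary in the compatibility
     axiom. *)
  move: (d - _) => k.
  apply: (homogeneous_product_eq0 (delta := delta) (k := k)) => [a' b'|a'|a' b' c].
  - by rewrite /f mulC (addrC a').
  - by rewrite /f Lgen0 mulr0 vcoef0.
  rewrite /f.
  have := congr1 (vcoef (a' + (b' + c) + k)) (mulE (Lgen K a') (Lgen K b') (Lgen K c)).
  rewrite virasoro_lieL mulZ !vcoefZ vcoefD vcoef_lie vcoef_lier.
  have -> : a' + (b' + c) + k - c = a' + b' + k by rewrite addrAC addrA addrK.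
  have -> : a' + (b' + c) + k - b' = a' + c + k.
    by rewrite addrAC (addrC b') addrA addrK.
  by rewrite (addrA b') (addrA c) (addrC b' a') (addrC c a').
elim/virasoro_ind=> [c x x' IHx IHx' y | a].
  by have := mull y c x x'; rewrite /= => ->; rewrite IHx IHx' scaler0 addr0.
elim/virasoro_ind=> [c y y' IHy IHy' | b]; last exact: mulLL.
by have := mulr (Lgen K a) c y y'; rewrite /= => ->; rewrite IHy IHy' scaler0 addr0.
Qed.

Theorem theorem3p4 (R : realType) (delta : R[i])
    (mul : virasoro_like R[i] -> virasoro_like R[i] -> virasoro_like R[i]) :
  transposed_poisson delta mul -> trivial_poisson mul.
Proof. by move=> mulP; left; apply: transposed_poisson_eq0 mulP. Qed.
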